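(* Let $p$ be a prime, let $E$ be an elementary abelian $p$-group of order $q$, let $\Bbbk$ be an infinite field of characteristic $p$, and let $W$ be a faithful indecomposable $\Bbbk E$-module of dimension $2$. Let $V=S^m(W)$, where $m$ is a nonnegative integer with $m<q$. Then the quotient algebra $\Bbbk[V]^E/I^E_{<E}$ is generated as a $\Bbbk$-algebra by (the images of) invariants of degree $\leq q$.
   Context: $S^m(W)$ denotes the $m$-th symmetric power of $W$ with its usual $E$-action. $\Bbbk[V]$ is the $\Bbbk$-algebra of polynomial functions $V\to\Bbbk$, identified with the symmetric algebra $S(V^* )$, graded by total degree, with action $(\sigma f)(v)=f(\sigma^{-1}v)$; $\Bbbk[V]^H$ is the subalgebra of $H$-fixed polynomials for $H\le E$. For $H\leq E$ the relative transfer $\mathrm{Tr}^E_H:\Bbbk[V]^H\to\Bbbk[V]^E$ is $\mathrm{Tr}^E_H(f)=\sum_{\sigma\in S}\sigma f$, where $S$ is a left transversal of $H$ in $E$; its image $I^E_H$ is an ideal of $\Bbbk[V]^E$. $I^E_{<E}$ denotes the sum of all the ideals $I^E_H$ over proper subgroups $H<E$. *)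

(* Defs.v *)
From HB Require Import structures.
From mathcomp Require Import all_boot all_order all_algebra all_fingroup.
From mathcomp Require Import all_solvable all_character.
From mathcomp.multinomials Require Import mpoly.

Set Implicit Arguments.
Unset Strict Implicit.
Unset Printing Implicit Defensive.

Import GRing.Theory.
Local Open Scope ring_scope.

(* Modules over k[G] are MathComp representations rG : mx_representation k G n,
   which act on row vectors on the right.  The left G-module attached to rG is
   'rV[k]_n with s . v = v *m rG s^-1; every left module of dimension n
   arises in this way, with the same submodules and the same kernel. *)

Section Modules.

Variables (k : fieldType) (gT : finGroupType) (G : {group gT}) (n : nat).
Variable rG : mx_representation k G n.

Definition lact (s : gT) (v : 'rV[k]_n) : 'rV[k]_n := v *m rG s^-1%g.

Lemma lactM (s t : gT) (v : 'rV[k]_n) :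
  s \in G -> t \in G -> lact (s * t)%g v = lact s (lact t v).
Proof. by move=> Gs Gt; rewrite /lact invMg repr_mxM ?groupV // mulmxA. Qed.

Definition mx_indecomposable : Prop :=
  (0 < n)%N /\
  forall U1 U2 : 'M[k]_n,
    mxmodule rG U1 -> mxmodule rG U2 ->
    mxdirect (U1 + U2) -> (U1 + U2 == 1%:M)%MS ->
    U1 = 0 \/ U2 = 0.

End Modules.

Section SymmetricPower.

Variables (k : fieldType) (n m : nat).

(* 'rV[k]_n is identified with the linear forms of {mpoly k[n]} = S('rV[k]_n);
   lin_subst A is the algebra endomorphism of the symmetric algebra
   that extends w |-> w *m A. *)
Definition lin_subst (A : 'M[k]_n) (p : {mpoly k[n]}) : {mpoly k[n]} :=
  p \mPo [tuple \sum_j A i j *: 'X_j | i < n].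

(* S^m('rV[k]_n) is the space of m.-homog polynomials, with its basis of
   monomials of degree m. *)
Definition sympow_monomials : {set 'X_{1..n < m.+1}} :=
  [set u : 'X_{1..n < m.+1} | mdeg u == m].

Definition sympow_dim : nat := #|sympow_monomials|.

Definition sympow_mnm (i : 'I_sympow_dim) : 'X_{1..n} :=
  bmnm (enum_val i).

Definition sympow_mx (A : 'M[k]_n) : 'M[k]_sympow_dim :=
  \matrix_(i, j) (lin_subst A 'X_[sympow_mnm i])@_(sympow_mnm j).

Definition sympow_poly (v : 'rV[k]_sympow_dim) : {mpoly k[n]} :=
  \sum_i v 0 i *: 'X_[sympow_mnm i].

Lemma lin_subst_comp (A B : 'M[k]_n) (p : {mpoly k[n]}) :
  lin_subst (A *m B) p = lin_subst B (lin_subst A p).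
Proof.
rewrite /lin_subst; elim/mpolyind: p => [|c u p _ _ IHp].
  by rewrite !comp_mpoly0.
rewrite !comp_mpolyD !comp_mpolyZ IHp; congr (_ *: _ + _).
rewrite !comp_mpolyX rmorph_prod; apply: eq_bigr => i _.
rewrite rmorphXn /=; congr (_ ^+ _); rewrite !tnth_mktuple linear_sum /=.
transitivity (\sum_j \sum_l (A i l * B l j) *: ('X_j : {mpoly k[n]})).
  by apply: eq_bigr => j _; rewrite mxE scaler_suml.
rewrite exchange_big /=; apply: eq_bigr => l _.
rewrite comp_mpolyZ comp_mpolyXU -tnth_nth tnth_mktuple scaler_sumr.
by apply: eq_bigr => j _; rewrite scalerA.
Qed.

Lemma lin_subst1 (p : {mpoly k[n]}) : lin_subst 1%:M p = p.
Proof.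
rewrite /lin_subst -[RHS]comp_mpoly_id; congr (_ \mPo _).
apply: eq_from_tnth => i; rewrite !tnth_mktuple (bigD1 i) //= mxE eqxx scale1r.
by rewrite big1 ?addr0 // => j /negPf ji; rewrite mxE eq_sym ji scale0r.
Qed.

Lemma lin_subst_homog (A : 'M[k]_n) (d : nat) (p : {mpoly k[n]}) :
  p \is d.-homog -> lin_subst A p \is d.-homog.
Proof.
move=> /dhomogP hp; rewrite /lin_subst comp_mpolyEX big_seq rpred_sum // => u pu.
have <- : mdeg u = d by exact: hp.
apply: rpredZ; rewrite comp_mpolyX mdegE.
elim/big_ind2: _ => [|x1 x2 y1 y2 h1 h2|i _]; first exact: dhomog1.
  exact: dhomogM.
rewrite tnth_mktuple.
have h : \sum_j A i j *: ('X_j : {mpoly k[n]}) \is 1.-homog.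
  by rewrite rpred_sum // => j _; rewrite rpredZ // dhomogX; apply/eqP/mdeg1.
by have := dhomogMn (u i) h; rewrite mul1n.
Qed.

Lemma sympow_mnm_inj : injective sympow_mnm.
Proof. by move=> i j /val_inj/enum_val_inj. Qed.

Lemma mdeg_sympow_mnm i : mdeg (sympow_mnm i) = m.
Proof. by have := enum_valP i; rewrite inE => /eqP. Qed.

Lemma sympow_mnmP (u : 'X_{1..n}) :
  mdeg u = m -> exists i, sympow_mnm i = u.
Proof.
move=> du; have ltu : (mdeg u < m.+1)%N by rewrite du.
have uS : BMultinom ltu \in sympow_monomials by rewrite inE /= du.
by exists (enum_rank_in uS (BMultinom ltu)); rewrite /sympow_mnm enum_rankK_in.
Qed.

Lemma sympow_polyE v i : (sympow_poly v)@_(sympow_mnm i) = v 0 i.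
Proof.
rewrite /sympow_poly raddf_sum /= (bigD1 i) //= mcoeffZ mcoeffX eqxx mulr1.
rewrite big1 ?addr0 // => j ji; rewrite mcoeffZ mcoeffX.
by rewrite (inj_eq sympow_mnm_inj) (negPf ji) mulr0.
Qed.

Lemma sympow_poly_homog v : sympow_poly v \is m.-homog.
Proof.
by rewrite rpred_sum // => i _; rewrite rpredZ // dhomogX; apply/eqP/mdeg_sympow_mnm.
Qed.

Lemma sympow_poly_inj : injective sympow_poly.
Proof. by move=> v w vw; apply/rowP=> i; rewrite -!sympow_polyE vw. Qed.

Lemma sympow_poly_onto (p : {mpoly k[n]}) :
  p \is m.-homog -> sympow_poly (\row_i p@_(sympow_mnm i)) = p.
Proof.
move=> hp; apply/mpolyP => u; have [du | du] := eqVneq (mdeg u) m.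
  by have [i <-] := sympow_mnmP du; rewrite sympow_polyE mxE.
rewrite (dhomog_nemf_coeff hp du).
exact: (dhomog_nemf_coeff (sympow_poly_homog _) du).
Qed.

Lemma sympow_poly_mulmx (A : 'M[k]_n) (v : 'rV[k]_sympow_dim) :
  sympow_poly (v *m sympow_mx A) = lin_subst A (sympow_poly v).
Proof.
rewrite -[RHS]sympow_poly_onto; last first.
  exact/lin_subst_homog/sympow_poly_homog.
congr sympow_poly; apply/rowP=> j; rewrite !mxE /lin_subst /sympow_poly.
set t := [tuple _ | i < n].
rewrite (linear_sum (comp_mpoly t)) (linear_sum (mcoeff (sympow_mnm j))) /=.
by apply: eq_bigr => i _; rewrite mxE comp_mpolyZ mcoeffZ.
Qed.

Lemma sympow_mx_repr (gT : finGroupType) (G : {group gT})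
    (rW : mx_representation k G n) :
  mx_repr G (fun s => sympow_mx (rW s)).
Proof.
split=> [|s t Gs Gt].
  apply/row_matrixP => i; rewrite !rowE; apply: sympow_poly_inj.
  by rewrite sympow_poly_mulmx repr_mx1 lin_subst1 mulmx1.
apply/row_matrixP => i; rewrite !rowE; apply: sympow_poly_inj.
rewrite mulmxA !sympow_poly_mulmx repr_mxM //; exact: lin_subst_comp.
Qed.

Definition sympow_repr (gT : finGroupType) (G : {group gT})
    (rW : mx_representation k G n) : mx_representation k G sympow_dim :=
  MxRepresentation (sympow_mx_repr rW).

End SymmetricPower.

Section Invariants.

Variables (k : fieldType) (gT : finGroupType) (E : {group gT}) (n : nat).
Variable rV : mx_representation k E n.

(* k[V] for V = 'rV[k]_n is {mpoly k[n]}, 'X_j being the j-th coordinate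
   function; lemma polact_eval states (s f)(v) = f(s^-1 . v). *)
Definition polact (s : gT) (f : {mpoly k[n]}) : {mpoly k[n]} :=
  f \mPo [tuple \sum_i rV s i j *: 'X_i | j < n].

Lemma polact_eval (s : gT) (f : {mpoly k[n]}) (v : 'rV[k]_n) :
  (polact s f).@[v 0] = f.@[(lact rV s^-1%g v) 0].
Proof.
rewrite /polact comp_mpoly_meval; apply: meval_eq => j.
rewrite tnth_mktuple /lact invgK mxE raddf_sum; apply: eq_bigr => i _.
by rewrite /= mevalZ mevalXU mulrC.
Qed.

Definition invariant (H : {set gT}) (f : {mpoly k[n]}) : Prop :=
  {in H, forall s, polact s f = f}.

Definition rel_transfer (H : {set gT}) (f : {mpoly k[n]}) : {mpoly k[n]} :=
  \sum_(s in transversal (lcosets H E) E) polact s f.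

Definition in_transfer_image (H : {set gT}) (f : {mpoly k[n]}) : Prop :=
  exists2 h, invariant H h & f = rel_transfer H h.

(* Membership in the sum of the ideals I^E_H over the proper subgroups H. *)
Definition in_proper_transfers (f : {mpoly k[n]}) : Prop :=
  exists2 F : {group gT} -> {mpoly k[n]},
    (forall H : {group gT}, H \proper E -> in_transfer_image H (F H))
    & f = \sum_(H : {group gT} | H \proper E) F H.

(* k[V]^E / I^E_{<E} is generated by the images of the invariants satisfying D:
   every invariant is congruent, modulo I^E_{<E}, to a polynomial expression in
   finitely many such invariants. *)
Definition quotient_generated_by (D : {mpoly k[n]} -> Prop) : Prop :=
  forall f, invariant E f ->
  exists (r : nat) (g : r.-tuple {mpoly k[n]}) (P : {mpoly k[r]}),
    (forall i, invariant E (tnth g i) /\ D (tnth g i)) /\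
    in_proper_transfers (f - (P \mPo g)).

Definition degree_le (d : nat) (f : {mpoly k[n]}) : Prop :=
  (msize f <= d.+1)%N.

Lemma polactM (s t : gT) f : s \in E -> t \in E ->
  polact (s * t)%g f = polact s (polact t f).
Proof.
move=> Es Et; rewrite /polact; elim/mpolyind: f => [|c u f _ _ IHf].
  by rewrite !comp_mpoly0.
rewrite !comp_mpolyD !comp_mpolyZ IHf; congr (_ *: _ + _).
rewrite !comp_mpolyX rmorph_prod; apply: eq_bigr => i _.
rewrite rmorphXn /=; congr (_ ^+ _); rewrite !tnth_mktuple linear_sum /=.
transitivity (\sum_j \sum_l (rV s j l * rV t l i) *: ('X_j : {mpoly k[n]})).
  by apply: eq_bigr => j _; rewrite repr_mxM // mxE scaler_suml.
rewrite exchange_big /=; apply: eq_bigr => l _.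
rewrite comp_mpolyZ comp_mpolyXU -tnth_nth tnth_mktuple scaler_sumr.
by apply: eq_bigr => j _; rewrite scalerA mulrC.
Qed.

Lemma lcosets_partition (H : {group gT}) :
  H \subset E -> partition (lcosets H E) E.
Proof.
move=> sHE; have tE x : x \in E -> (x *: H)%g \subset E.
  by move=> Ex; rewrite mul_subG ?sub1set.
apply/and3P; split.
- rewrite eqEsubset; apply/andP; split.
    by apply/bigcupsP=> _ /lcosetsP[x Ex ->]; exact: tE.
  apply/subsetP=> x Ex; apply/bigcupP; exists ((x *: H)%g).
    by apply/lcosetsP; exists x.
  exact: lcoset_refl.
- apply/trivIsetP=> _ _ /lcosetsP[x _ ->] /lcosetsP[y _ ->].
  apply: contraR => /pred0Pn[z /andP[/= xz yz]].
  by rewrite -(lcoset_eqP xz) -(lcoset_eqP yz).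
- by apply/lcosetsP=> -[x _ /setP/(_ x)]; rewrite lcoset_refl inE.
Qed.

Lemma rel_transfer_indep (H : {group gT}) (S : {set gT}) f :
  H \subset E -> invariant H f -> is_transversal S (lcosets H E) E ->
  \sum_(s in S) polact s f = rel_transfer H f.
Proof.
move=> sHE Hf trS.
have eqf x y : x \in E -> y \in (x *: H)%g -> polact y f = polact x f.
  by move=> Ex /lcosetP[h Hh ->]; have Eh := subsetP sHE h Hh; rewrite polactM // Hf.
have sumE T : is_transversal T (lcosets H E) E ->
    \sum_(s in T) polact s f = \sum_(A in lcosets H E) polact (repr A) f.
  move=> trT; rewrite -[in RHS](pblock_transversal trT) big_imset /=; last first.
    exact: (pblock_inj trT).
  apply: eq_bigr => s Ts; have Es := subsetP (transversal_sub trT) s Ts.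
  have /and3P[_ tI _] := lcosets_partition sHE.
  have sA : (s *: H)%g \in lcosets H E by apply/lcosetsP; exists s.
  rewrite (def_pblock tI sA) ?lcoset_refl //.
  by rewrite (eqf s) // (mem_repr s) ?lcoset_refl.
by rewrite sumE // /rel_transfer sumE //; exact/transversalP/lcosets_partition.
Qed.

End Invariants.

(* Main.v *)
Require Import Defs.
From HB Require Import structures.
From mathcomp Require Import all_boot all_order all_algebra all_fingroup.
From mathcomp Require Import all_solvable all_character.
From mathcomp Require Import ring.
From mathcomp.multinomials Require Import mpoly.

(** The points of V = S^m(W) are the binary forms F of degree m.  Take a point P
of the plane that is an eigenvector of no s <> 1 in E, and for t in E let
l_t be the linear form F |-> F(t^-1 P) on V.  The l_t form a single E-orbit
(s sends l_t to l_(t s^-1)), and they are in general position: the points t^-1 P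
lie on pairwise distinct lines, so for m + 1 of them a product of m linear forms
vanishes at all but a prescribed one.  Thus any m + 1 of the l_t are a basis of
V^*.  Such a P exists because a non-scalar 2 x 2 matrix has at most two
eigenlines, k is infinite, and no s <> 1 acts as a scalar: a p-th root of unity in
characteristic p is 1, and W is faithful.

The rest only uses that orbit (general_position_quotient), for an arbitrary
finite group E of order q and a module V of dimension n <= q; here n = m + 1.
Let J_r be the ideal of k[V] generated by the products of all l_t
with t in E \ T, over the r-element subsets T of E.  Then J_q = k[V] and
J_0 is generated by the norm N, the product of all the l_t, of degree q.

- Every monomial of degree at least q - r lies in J_r when r >= n - 1
  (arr_ideal_monomial).  Indeed, when T has n or more elements,
  the l_t with t in T span V^*, so multiplying a generator of J_(r+1) by a
  variable lands in J_r.

- When r + 1 < n, an invariant in J_(r+1) is congruent to an invariant in J_r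
  modulo proper transfers (arr_ideal_descent).  There is a family of algebra
  endomorphisms pi_T of k[V], compatible with E, such that pi_T kills l_t for t in T
  and is the identity modulo those l_t; for binary forms, one may think of the map
  that subtracts from F its Lagrange interpolation at the points of T.  If the invariant f is
  the sum over T of l_(E \ T) g_T, then pi_T f = pi_T(l_(E \ T)) pi_T(g_T)
  because pi_T kills the other summands, and cancelling pi_T(l_(E \ T)) shows that E
  permutes the polynomials pi_T(g_T) like the sets T.  No set T with
  0 < |T| < q is stable under E, so the sum of the
  l_(E \ T) pi_T(g_T) is a sum of transfers from stabilisers, which are proper
  subgroups.  What is left of f is a combination of
  l_(E \ T) (g_T - pi_T(g_T)), and so lies in J_r.

Hence, modulo proper transfers, an invariant all of whose monomials have degree at
least q is N times an invariant of smaller degree.  By induction the quotient is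
generated by N and the invariants of degree less than q. *)

Set Implicit Arguments.
Unset Strict Implicit.
Unset Printing Implicit Defensive.

Import GRing.Theory.
Local Open Scope ring_scope.

(** * Linear substitutions and homogeneous components *)

Section LinSubst.

Variables (k : fieldType) (n : nat).
Implicit Types (A : 'M[k]_n) (f g : {mpoly k[n]}).

Lemma lin_substD A f g : lin_subst A (f + g) = lin_subst A f + lin_subst A g.
Proof. exact: comp_mpolyD. Qed.

Lemma lin_substB A f g : lin_subst A (f - g) = lin_subst A f - lin_subst A g.
Proof. exact: comp_mpolyB. Qed.

Lemma lin_substZ A c f : lin_subst A (c *: f) = c *: lin_subst A f.
Proof. exact: comp_mpolyZ. Qed.

Lemma lin_substM A f g : lin_subst A (f * g) = lin_subst A f * lin_subst A g.
Proof. exact: rmorphM. Qed.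

Lemma lin_subst_sum A I (r : seq I) (P : pred I) (F : I -> {mpoly k[n]}) :
  lin_subst A (\sum_(i <- r | P i) F i) = \sum_(i <- r | P i) lin_subst A (F i).
Proof. exact: (linear_sum (comp_mpoly _)). Qed.

Lemma lin_subst_prod A I (r : seq I) (P : pred I) (F : I -> {mpoly k[n]}) :
  lin_subst A (\prod_(i <- r | P i) F i) = \prod_(i <- r | P i) lin_subst A (F i).
Proof. exact: rmorph_prod. Qed.

Lemma lin_subst_pihomog A d f :
  lin_subst A (pihomog mdeg d f) = pihomog mdeg d (lin_subst A f).
Proof.
elim/mpolyind: f => [|c u f _ _ IHf].
  by rewrite pihomog0 /lin_subst comp_mpoly0 pihomog0.
rewrite !(lin_substD, linearD) /= IHf; congr (_ + _).
rewrite lin_substZ !linearZ /= lin_substZ; congr (_ *: _).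
have hX : lin_subst A 'X_[u] \is (mdeg u).-homog.
  by apply: lin_subst_homog; rewrite dhomogX.
rewrite pihomogX; case: eqP => [<-|/eqP ne]; first by rewrite pihomog_dE.
by rewrite (pihomog_ne0 ne hX) /lin_subst comp_mpoly0.
Qed.

Lemma lin_substX A j : lin_subst A 'X_j = \sum_i A j i *: 'X_i.
Proof. by rewrite /lin_subst comp_mpolyXU -tnth_nth tnth_mktuple. Qed.

End LinSubst.

(** * Sums of transfers from proper subgroups *)

Section Transfers.

Variables (k : fieldType) (gT : finGroupType) (E : {group gT}) (n : nat).
Variable rV : mx_representation k E n.
Implicit Types (f g : {mpoly k[n]}) (s : gT).

Lemma polactE s f : polact rV s f = lin_subst (rV s)^T f.
Proof.
congr (f \mPo _); apply: eq_from_tnth => j; rewrite !tnth_mktuple.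
by apply: eq_bigr => i _; rewrite mxE.
Qed.

Lemma polact0 s : polact rV s 0 = 0.
Proof. exact: comp_mpoly0. Qed.

Lemma polactD s f g : polact rV s (f + g) = polact rV s f + polact rV s g.
Proof. by rewrite !polactE lin_substD. Qed.

Lemma polactB s f g : polact rV s (f - g) = polact rV s f - polact rV s g.
Proof. by rewrite !polactE lin_substB. Qed.

Lemma polact_mul s f g : polact rV s (f * g) = polact rV s f * polact rV s g.
Proof. by rewrite !polactE lin_substM. Qed.

Lemma polact_sum s I (r : seq I) (P : pred I) (F : I -> {mpoly k[n]}) :
  polact rV s (\sum_(i <- r | P i) F i) = \sum_(i <- r | P i) polact rV s (F i).
Proof. by rewrite polactE lin_subst_sum; apply: eq_bigr => i; rewrite polactE. Qed.

Lemma rel_transferD (H : {set gT}) f g :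
  rel_transfer rV H (f + g) = rel_transfer rV H f + rel_transfer rV H g.
Proof. by rewrite -big_split; apply: eq_bigr => s _; rewrite polactD. Qed.

Lemma in_proper_transfers0 : in_proper_transfers rV 0.
Proof.
exists (fun _ => 0); last by rewrite big1.
by move=> H _; exists 0 => [s _|]; rewrite ?polact0 // /rel_transfer big1 // => s _;
   rewrite polact0.
Qed.

Lemma in_proper_transfersD f g :
  in_proper_transfers rV f -> in_proper_transfers rV g ->
  in_proper_transfers rV (f + g).
Proof.
case=> F Fp -> [G Gp ->]; exists (fun H => F H + G H); last by rewrite big_split.
move=> H pH; have [a Ha ->] := Fp H pH; have [b Hb ->] := Gp H pH.
exists (a + b); last by rewrite rel_transferD.
by move=> s Hs; rewrite polactD Ha ?Hb.
Qed.

Lemma in_proper_transfers_sum I (r : seq I) (P : pred I) (F : I -> {mpoly k[n]}) :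
  (forall i, P i -> in_proper_transfers rV (F i)) ->
  in_proper_transfers rV (\sum_(i <- r | P i) F i).
Proof.
move=> FP; elim/big_ind: _ => //; first exact: in_proper_transfers0.
exact: in_proper_transfersD.
Qed.

Lemma in_proper_transfersMl f g :
  Defs.invariant rV E f -> in_proper_transfers rV g ->
  in_proper_transfers rV (f * g).
Proof.
move=> fE [G Gp ->]; exists (fun H => f * G H); last by rewrite mulr_sumr.
move=> H pH; have [a Ha ->] := Gp H pH.
exists (f * a).
  by move=> s Hs; rewrite polact_mul Ha // fE // (subsetP (proper_sub pH)).
rewrite mulr_sumr; apply: eq_bigr => s sX; rewrite polact_mul fE //.
have /transversal_sub := transversalP (lcosets_partition (proper_sub pH)).
by move/subsetP; apply.
Qed.

Lemma in_proper_transfers_pihomog d f :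
  in_proper_transfers rV f -> in_proper_transfers rV (pihomog mdeg d f).
Proof.
case=> F Fp ->; exists (fun H => pihomog mdeg d (F H)); last by rewrite linear_sum.
move=> H pH; have [a Ha ->] := Fp H pH.
exists (pihomog mdeg d a).
  by move=> s Hs; rewrite polactE lin_subst_pihomog -polactE Ha.
rewrite linear_sum; apply: eq_bigr => s _ /=.
by rewrite !polactE lin_subst_pihomog.
Qed.

Lemma in_proper_transfers_transfer (H : {group gT}) h :
  H \proper E -> Defs.invariant rV H h -> in_proper_transfers rV (rel_transfer rV H h).
Proof.
move=> pH hH.
have z (K : {group gT}) : in_transfer_image rV K 0.
  by exists 0 => [s _|]; rewrite ?polact0 // /rel_transfer big1 // => s _;
     rewrite polact0.
exists (fun K : {group gT} => if K == H then rel_transfer rV H h else 0).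
  move=> K _; case: eqP => [->|_]; last exact: z.
  by exists h.
by rewrite (bigD1 H) //= eqxx big1 ?addr0 // => K /andP[_ /negPf->].
Qed.

(** The action on k[V] is a left action and the one on the indices a right
action, hence the inverse; it also matches left cosets of the stabiliser with
points of the orbit, which is why the transversal of the transfer runs once over the
orbit. *)
Lemma sum_orbit_transfer (aT : finType) (to : {action gT &-> aT})
    (h : aT -> {mpoly k[n]}) x :
  (forall s y, s \in E -> y \in orbit to E x ->
     polact rV s (h y) = h (to y s^-1%g)) ->
  \sum_(y in orbit to E x) h y = rel_transfer rV 'C_E[x | to]%g (h x).
Proof.
move=> hE; pose H := 'C_E[x | to]%G.
have sHE : H \subset E by exact: subsetIl.
have partH := lcosets_partition sHE; have trH := transversalP partH.
have XE s : s \in transversal (lcosets H E) E -> s \in E.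
  exact/subsetP/(transversal_sub trH).
have -> : orbit to E x =
    [set to x s^-1%g | s in transversal (lcosets H E) E].
  apply/setP=> y; apply/orbitP/imsetP=> [[a Ea <-]|[s Xs ->]]; last first.
    by exists s^-1%g => //; rewrite groupV XE.
  have cE : (a^-1 *: H)%g \in lcosets H E.
    by apply/lcosetsP; exists a^-1%g; rewrite ?groupV.
  move: cE; rewrite -{1}(pblock_transversal trH) => /imsetP[s Xs eqs].
  have: a^-1%g \in pblock (lcosets H E) s by rewrite -eqs lcoset_refl.
  have /and3P[_ tI _] := partH.
  have sA : (s *: H)%g \in lcosets H E by apply/lcosetsP; exists s; rewrite ?XE.
  rewrite (def_pblock tI sA) ?lcoset_refl // => /lcosetP[c].
  rewrite inE => /andP[_ /astab1P cx] def_a; exists s => //.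
  by rewrite -[a]invgK def_a invMg actM -{1}cx actK.
rewrite big_imset /=.
  by apply: eq_bigr => s Xs; rewrite -hE ?XE ?orbit_refl.
move=> s t Xs Xt eqst; apply: (pblock_inj trH Xs Xt).
have /and3P[_ tI _] := partH.
have bl u : u \in transversal (lcosets H E) E ->
    pblock (lcosets H E) u = (u *: H)%g.
  move=> Xu; apply: (def_pblock tI); last exact: lcoset_refl.
  by apply/lcosetsP; exists u; rewrite ?XE.
rewrite !bl //; apply/lcoset_eqP; rewrite mem_lcoset inE groupM ?groupV ?XE //=.
by apply/astab1P; rewrite actM -eqst actKV.
Qed.

(** This is the only source of transfers in the proof: each orbit of indices
contributes a transfer from the stabiliser of one of its points. *)
Lemma sum_permuted_transfers (aT : finType) (to : {action gT &-> aT})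
    (O : {set aT}) (h : aT -> {mpoly k[n]}) :
  [acts E, on O | to] ->
  (forall x, x \in O -> ~~ (E \subset 'C[x | to]%g)) ->
  (forall s x, s \in E -> x \in O -> polact rV s (h x) = h (to x s^-1%g)) ->
  in_proper_transfers rV (\sum_(x in O) h x).
Proof.
move=> actO nfix hE; rewrite (set_partition_big _ (orbit_partition actO)) /=.
apply: in_proper_transfers_sum => _ /imsetP[x Ox ->].
have hx s y : s \in E -> y \in orbit to E x ->
    polact rV s (h y) = h (to y s^-1%g).
  by move=> Es xy; apply: hE => //; apply: acts_in_orbit xy Ox.
rewrite (sum_orbit_transfer hx).
apply: (@in_proper_transfers_transfer 'C_E[x | to]%G).
  by rewrite properE subsetIl subsetI subxx /= nfix.
move=> s /setIP[Es /astab1P sx]; rewrite hE //; congr h.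
by rewrite -{1}sx actK.
Qed.

End Transfers.

(** * Linear forms *)

Section LinearForms.

Variables (k : fieldType) (n : nat).
Implicit Types (a b : 'cV[k]_n) (A : 'M[k]_n).

Definition linform a : {mpoly k[n]} := \sum_i a i 0 *: 'X_i.

Lemma linform_is_linear : linear linform.
Proof.
move=> x a b; rewrite /linform scaler_sumr -big_split; apply: eq_bigr => i _ /=.
by rewrite !mxE scalerDl scalerA.
Qed.

HB.instance Definition _ :=
  GRing.isLinear.Build k 'cV[k]_n {mpoly k[n]} _ linform linform_is_linear.

Lemma linform_delta j : linform (delta_mx j 0) = 'X_j.
Proof.
rewrite /linform (bigD1 j) //= mxE !eqxx scale1r big1 ?addr0 // => i /negPf ij.
by rewrite mxE ij scale0r.
Qed.

Lemma linform_eq0 a : linform a = 0 -> a = 0.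
Proof.
move=> a0; apply/colP => i; have := congr1 (mcoeff U_(i)) a0.
rewrite mcoeff0 raddf_sum (bigD1 i) //= mcoeffZ mcoeffXU eqxx mulr1.
by rewrite mxE big1 ?addr0 // => j /negPf ji; rewrite mcoeffZ mcoeffXU ji mulr0.
Qed.

Lemma linform_homog a : linform a \is 1.-homog.
Proof.
by rewrite rpred_sum // => i _; rewrite rpredZ // dhomogX; apply/eqP/mdeg1.
Qed.

Lemma lin_subst_linform A a : lin_subst A^T (linform a) = linform (A *m a).
Proof.
rewrite lin_subst_sum.
under eq_bigr => i _ do rewrite lin_substZ lin_substX scaler_sumr.
rewrite exchange_big; apply: eq_bigr => i _ /=.
rewrite mxE scaler_suml; apply: eq_bigr => j _.
by rewrite scalerA mxE mulrC.
Qed.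

(** It suffices to test on the variables that a substitution is the identity modulo
an ideal D, because
A(fg) - fg = (Af - f) Ag + (Ag - g) f. *)
Lemma lin_subst_ideal (A : 'M[k]_n) (D : {mpoly k[n]} -> Prop) :
  D 0 -> (forall f g, D f -> D g -> D (f + g)) ->
  (forall f g, D f -> D (f * g)) ->
  (forall j, D (lin_subst A 'X_j - 'X_j)) ->
  forall f, D (lin_subst A f - f).
Proof.
move=> D0 DD DM DX.
have Dmul f g : D (lin_subst A f - f) -> D (lin_subst A g - g) ->
    D (lin_subst A (f * g) - f * g).
  move=> Df Dg; have -> : lin_subst A (f * g) - f * g =
      (lin_subst A f - f) * lin_subst A g + (lin_subst A g - g) * f.
    by rewrite lin_substM !mulrBl [f * lin_subst A g]mulrC addrA subrK [f * g]mulrC.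
  by apply: DD; apply: DM.
have D1 : D (lin_subst A 1 - 1) by rewrite /lin_subst comp_mpoly1 subrr.
elim/mpolyind => [|c u f _ _ IHf]; first by rewrite /lin_subst comp_mpoly0 subrr.
rewrite lin_substD lin_substZ opprD addrACA -scalerBr; apply: DD => //.
rewrite -mul_mpolyC mulrC; apply: DM; rewrite mpolyXE_id.
elim/big_rec: _ => // i x _ Dx; apply: (Dmul) => //.
by elim: (u i) => [|e IHe]; rewrite ?expr0 // exprS; apply: (Dmul).
Qed.

End LinearForms.

(** * The arrangement of an orbit in general position *)

Section Arrangement.

Variables (k : fieldType) (gT : finGroupType) (E : {group gT}) (n : nat).
Variables (rV : mx_representation k E n) (z : 'cV[k]_n).
Implicit Types (T : {set gT}) (s t : gT) (f g : {mpoly k[n]}).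

(** The inverse makes the left action of E on linear forms a right translation of
the index, so that subsets of E are moved by right translation. *)
Definition orbit_vec t : 'cV[k]_n := rV t^-1%g *m z.
Definition orbit_form t : {mpoly k[n]} := linform (orbit_vec t).

(** Indexed by the complement of the product, so that the ideals arr_ideal r below increase
with r up to #|E|. *)
Definition coprod T : {mpoly k[n]} := \prod_(t in E :\: T) orbit_form t.

Definition subsets r : {set {set gT}} := [set T : {set gT} | (T \subset E) && (#|T| == r)].

Definition arr_ideal r f : Prop :=
  exists g : {set gT} -> {mpoly k[n]}, f = \sum_(T in subsets r) coprod T * g T.

Lemma polact_orbit_form s t : s \in E -> t \in E ->
  polact rV s (orbit_form t) = orbit_form (t * s^-1)%g.
Proof.
move=> Es Et; rewrite polactE lin_subst_linform /orbit_form /orbit_vec.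
by rewrite mulmxA -repr_mxM ?groupV // invMg invgK.
Qed.

Lemma polact_coprod s T : s \in E -> T \subset E ->
  polact rV s (coprod T) = coprod (T :* s^-1)%g.
Proof.
move=> Es sTE; rewrite polactE lin_subst_prod /coprod.
have -> : E :\: (T :* s^-1)%g = [set t * s^-1 | t in E :\: T]%g.
  apply/setP=> t; rewrite !inE mem_rcoset invgK; apply/andP/imsetP.
    case=> nTt Et; exists (t * s)%g; last by rewrite mulgK.
    by rewrite inE nTt groupM.
  by case=> u /setDP[Eu nTu] ->; rewrite mulgKV nTu groupM ?groupV.
rewrite big_imset /=; last by move=> t u _ _ /mulIg.
by apply: eq_bigr => t /setDP[Et _]; rewrite -polactE polact_orbit_form.
Qed.

Lemma arr_ideal0 r : arr_ideal r 0.
Proof. by exists (fun=> 0); rewrite big1 // => T _; rewrite mulr0. Qed.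

Lemma arr_idealD r f g : arr_ideal r f -> arr_ideal r g -> arr_ideal r (f + g).
Proof.
case=> a -> [b ->]; exists (fun T => a T + b T).
by rewrite -big_split; apply: eq_bigr => T _; rewrite mulrDr.
Qed.

Lemma arr_idealMr r f g : arr_ideal r f -> arr_ideal r (f * g).
Proof.
case=> a ->; exists (fun T => a T * g).
by rewrite mulr_suml; apply: eq_bigr => T _; rewrite mulrA.
Qed.

Lemma arr_ideal_sum r I (s : seq I) (P : pred I) (F : I -> {mpoly k[n]}) :
  (forall i, P i -> arr_ideal r (F i)) -> arr_ideal r (\sum_(i <- s | P i) F i).
Proof.
by move=> FP; elim/big_ind: _ => //; [exact: arr_ideal0|exact: arr_idealD].
Qed.

Lemma arr_ideal_coprod r T f : T \in subsets r -> arr_ideal r (coprod T * f).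
Proof.
move=> rT; exists (fun U => if U == T then f else 0).
rewrite (bigD1 T) //= eqxx big1 ?addr0 // => U /andP[_ /negPf->].
by rewrite mulr0.
Qed.

(** Multiplying by the form of index t in T completes the product to that of the
complement of T minus t. *)
Lemma arr_ideal_orbit_form r T t : T \in subsets r.+1 -> t \in T ->
  arr_ideal r (coprod T * orbit_form t).
Proof.
rewrite inE => /andP[sTE /eqP cT] Tt.
have -> : coprod T * orbit_form t = coprod (T :\ t) * 1.
  have Et := subsetP sTE t Tt.
  rewrite mulr1 /coprod; have -> : E :\: (T :\ t) = t |: (E :\: T).
    by apply/setP=> u; rewrite !inE negb_and negbK; case: eqVneq => [->|].
  by rewrite big_setU1 ?inE ?Tt //= mulrC.
apply: arr_ideal_coprod; rewrite inE (subset_trans (subsetDl _ _)) //=.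
by move: (cardsD1 t T); rewrite Tt cT add1n => -[->].
Qed.

(** By translation it is enough to separate the form of index 1 from those of the other
elements of T, by a vector c of V on which it takes the value 1. *)
Definition general_position : Prop :=
  forall T, T \subset E -> (#|T| <= n)%N -> 1%g \in T ->
  exists c : 'rV[k]_n, forall t, t \in T ->
    c *m orbit_vec t = (t == 1%g)%:R%:M.

Definition dual_family (c : {set gT} -> 'rV[k]_n) : Prop :=
  forall T t, T \subset E -> (#|T| <= n)%N -> 1%g \in T -> t \in T ->
  c T *m orbit_vec t = (t == 1%g)%:R%:M.

Lemma general_position_dual : general_position -> exists c, dual_family c.
Proof.
move=> gp; have /fin_all_exists[c cP] T : exists c : 'rV[k]_n,
    T \subset E -> (#|T| <= n)%N -> 1%g \in T -> forall t, t \in T ->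
    c *m orbit_vec t = (t == 1%g)%:R%:M.
  case: (boolP [&& T \subset E, (#|T| <= n)%N & 1%g \in T]) => [/and3P[h1 h2 h3]|].
    by have [c cP] := gp T h1 h2 h3; exists c.
  by move=> nT; exists 0 => h1 h2 h3; rewrite h1 h2 h3 in nT.
by exists c => T t h1 h2 h3; apply: cP.
Qed.

Section Projections.

Variable c : {set gT} -> 'rV[k]_n.
Hypothesis cP : dual_family c.

(** The dual basis of the forms indexed by T.  It is transported from the chosen vectors
of the translates of T that contain 1, rather than chosen for T directly: this is
what makes the projections below compatible with E, although the choice of c is
arbitrary. *)
Definition dual T s : 'rV[k]_n := c (T :* s^-1)%g *m rV s.

(** The projection of V onto the common zeros of the forms indexed by T, along the span
of their dual basis. *)
Definition proj T : 'M[k]_n := 1%:M - \sum_(s in T) orbit_vec s *m dual T s.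

Lemma dualP T s t : T \subset E -> (#|T| <= n)%N -> s \in T -> t \in T ->
  dual T s *m orbit_vec t = (s == t)%:R%:M.
Proof.
move=> sTE cT Ts Tt; have [Es Et] := (subsetP sTE s Ts, subsetP sTE t Tt).
rewrite /dual /orbit_vec -mulmxA (mulmxA (rV s)) -repr_mxM ?groupV //.
have -> : (s * t^-1 = (t * s^-1)^-1)%g by rewrite invMg invgK.
rewrite cP ?mem_rcoset ?invgK ?mulgKV ?mul1g //.
- by rewrite -eq_mulgV1 eq_sym.
- by apply/subsetP=> u; rewrite mem_rcoset invgK -{2}(mulgK s u) => /(subsetP sTE) Eus; rewrite groupM ?groupV.
- by rewrite card_rcoset.
Qed.

Lemma proj_orbit_vec T t : T \subset E -> (#|T| <= n)%N -> t \in T ->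
  proj T *m orbit_vec t = 0.
Proof.
move=> sTE cT Tt; rewrite /proj mulmxBl mul1mx mulmx_suml (bigD1 t) //=.
rewrite -mulmxA dualP // eqxx mulmx1 big1 ?addr0 ?subrr // => s /andP[Ts /negPf st].
by rewrite -mulmxA dualP // st mulr0n raddf0 mulmx0.
Qed.

(** The dual vector at s of T with s added is fixed by the projection, and the form
of index s takes the value 1 on it. *)
Lemma proj_orbit_vec_neq0 T s : T \subset E -> (#|T| < n)%N -> s \in E :\: T ->
  proj T *m orbit_vec s != 0.
Proof.
move=> sTE cT /setDP[Es nTs]; apply/eqP => p0.
pose U := s |: T.
have sUE : U \subset E by rewrite subUset sub1set Es.
have cU : (#|U| <= n)%N by rewrite cardsU1 nTs.
have Us : s \in U by rewrite setU11.
have: dual U s *m (proj T *m orbit_vec s) = 0 by rewrite p0 mulmx0.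
rewrite mulmxA /proj mulmxBr mulmx1 mulmx_sumr big1 => [|t Tt]; last first.
  rewrite mulmxA (dualP sUE cU Us) ?setU1r //; have /negPf-> : s != t.
    by apply: contraNneq nTs => ->.
  by rewrite mulr0n raddf0 mul0mx.
rewrite subr0 (dualP sUE cU Us Us) eqxx => /matrixP/(_ 0 0); rewrite !mxE.
by move/eqP; rewrite oner_eq0.
Qed.

(** Here the dual families are bases of V^* and V, and the identity is
the sum of the rank one maps that they define; in matrix terms, a one-sided inverse of a
square matrix is two-sided. *)
Lemma proj_full T : T \subset E -> #|T| = n -> proj T = 0.
Proof.
move=> sTE cT; pose e (i : 'I_n) := nth 1%g (enum T) i.
have eT i : e i \in T by rewrite -mem_enum mem_nth // -cardE cT.
have einj i j : (e i == e j) = (i == j).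
  by rewrite nth_uniq ?enum_uniq // -cardE cT.
pose D := \matrix_(i, j) dual T (e i) 0 j.
pose L := \matrix_(i, j) orbit_vec (e j) i 0.
have DL : D *m L = 1%:M.
  apply/matrixP=> i j; have /matrixP/(_ 0 0) := dualP sTE (eq_leq cT) (eT i) (eT j).
  rewrite !mxE einj eqxx mulr1n => <-.
  by apply: eq_bigr => l _; rewrite !mxE.
apply/eqP; rewrite subr_eq0 -(mulmx1C DL); apply/eqP/matrixP => i j.
rewrite -big_enum (big_nth 1%g) -cardE cT big_mkord summxE mxE.
by apply: eq_bigr => l _; rewrite [RHS]mxE big_ord1; congr (_ * _); rewrite [LHS]mxE.
Qed.

(** Translating T by s^-1 permutes the rank one summands, because the chosen vector in
the dual family depends only on T :* t^-1, which is also the translate of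
T :* s^-1 by the inverse of t * s^-1. *)
Lemma proj_equiv T s : s \in E -> T \subset E ->
  rV s *m proj T = proj (T :* s^-1)%g *m rV s.
Proof.
move=> Es sTE; rewrite /proj mulmxBr mulmxBl mulmx1 mul1mx; congr (_ - _).
rewrite mulmx_sumr mulmx_suml.
rewrite [RHS](reindex_inj (mulIg s^-1%g)); apply: eq_big => [t|t Tt] /=.
  by rewrite mem_rcoset mulgK.
have Et := subsetP sTE t Tt.
rewrite /orbit_vec /dual invMg !invgK -rcosetM mulKg.
by rewrite repr_mxM ?groupV // repr_mxM ?groupV // !mulmxA repr_mxKV.
Qed.

Definition proj_subst T f := lin_subst (proj T)^T f.

Lemma polact_proj s T f : s \in E -> T \subset E ->
  polact rV s (proj_subst T f) = proj_subst (T :* s^-1)%g (polact rV s f).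
Proof.
move=> Es sTE; rewrite !polactE /proj_subst -!lin_subst_comp.
by rewrite -!trmx_mul proj_equiv.
Qed.

Lemma proj_subst_orbit_form T t : T \subset E -> (#|T| <= n)%N -> t \in T ->
  proj_subst T (orbit_form t) = 0.
Proof.
move=> sTE cT Tt; rewrite /proj_subst lin_subst_linform proj_orbit_vec //.
by rewrite /linform big1 // => i _; rewrite mxE scale0r.
Qed.

Lemma proj_subst_coprod_neq0 T : T \subset E -> (#|T| < n)%N ->
  proj_subst T (coprod T) != 0.
Proof.
move=> sTE cT; rewrite /proj_subst lin_subst_prod.
apply/prodf_neq0 => t tT; apply: contra (proj_orbit_vec_neq0 sTE cT tT).
by rewrite lin_subst_linform => /eqP/linform_eq0/eqP.
Qed.

Lemma proj_subst_coprod_eq0 r T U : (r <= n)%N ->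
  T \in subsets r -> U \in subsets r -> U != T -> proj_subst T (coprod U) = 0.
Proof.
rewrite !inE => rn /andP[sTE /eqP cT] /andP[_ /eqP cU] neUT.
have /subsetPn[t Tt nUt] : ~~ (T \subset U).
  by apply: contraNN neUT => sTU; rewrite eq_sym eqEcard sTU cT cU leqnn.
rewrite /proj_subst lin_subst_prod (bigD1 t) /=; last first.
  by rewrite inE nUt (subsetP sTE).
by rewrite -/(proj_subst T _) proj_subst_orbit_form ?mul0r // cT.
Qed.

Lemma proj_substX_sub T j : proj_subst T 'X_j - 'X_j =
  \sum_(s in T) - dual T s 0 j *: orbit_form s.
Proof.
rewrite -linform_delta /proj_subst lin_subst_linform -linearB.
rewrite /proj mulmxBl mul1mx addrC addrA addNr add0r mulmx_suml -sumrN linear_sum.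
apply: eq_bigr => s _ /=; rewrite linearN scaleNr -linearZ; congr (- linform _).
by rewrite -mulmxA -colE [col j _]mx11_scalar mul_mx_scalar mxE.
Qed.

Lemma arr_ideal_proj_sub r T f : T \in subsets r.+1 ->
  arr_ideal r (coprod T * (proj_subst T f - f)).
Proof.
move=> rT; pose D f := arr_ideal r (coprod T * f); rewrite -/(D _).
apply: lin_subst_ideal => [|a b Da Db|a b Da|j].
- by rewrite /D mulr0; apply: arr_ideal0.
- by rewrite /D mulrDr; apply: arr_idealD.
- by rewrite /D mulrA; apply: arr_idealMr.
rewrite /D -/(proj_subst _ _) proj_substX_sub mulr_sumr.
apply: arr_ideal_sum => s Ts; rewrite -scalerAr -mul_mpolyC mulrC.
by apply/arr_idealMr/arr_ideal_orbit_form.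
Qed.

(** When T has at least n elements, n of the forms indexed by T already span the linear
forms. *)
Lemma arr_ideal_coprodX r T j : T \in subsets r.+1 -> (n <= r.+1)%N ->
  arr_ideal r (coprod T * 'X_j).
Proof.
move=> rT nr; have /[!inE] /andP[sTE /eqP cT] := rT.
have : (0 < #|[set U : {set gT} | U \subset T & #|U| == n]|)%N.
  by rewrite cards_draws bin_gt0 cT.
case/card_gt0P => U /[!inE] /andP[sUT /eqP cU].
have sUE := subset_trans sUT sTE.
have -> : 'X_j = \sum_(s in U) dual U s 0 j *: orbit_form s.
  rewrite -[LHS]opprK -[- 'X_j]add0r.
  have {1}-> : 0 = proj_subst U 'X_j.
    by rewrite /proj_subst proj_full // lin_substX big1 // => i _; rewrite !mxE scale0r.
  rewrite proj_substX_sub -sumrN; apply: eq_bigr => s _.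
  by rewrite scaleNr opprK.
rewrite mulr_sumr; apply: arr_ideal_sum => s Us; rewrite -scalerAr -mul_mpolyC mulrC.
by apply/arr_idealMr/arr_ideal_orbit_form => //; apply: (subsetP sUT).
Qed.

Lemma arr_ideal_full f : arr_ideal #|E| f.
Proof.
have := @arr_ideal_coprod #|E| E f; rewrite /coprod setDv big_set0 mul1r; apply.
by rewrite inE subxx eqxx.
Qed.

(** Downward induction on r from r = #|E|, where the ideal is the whole ring: each step
down costs one variable. *)
Lemma arr_ideal_monomial r u : (n <= r.+1)%N -> (r <= #|E|)%N ->
  (#|E| <= r + mdeg u)%N -> arr_ideal r 'X_[u].
Proof.
move=> nr rE; move def_d: (#|E| - r)%N => d.
elim: d r u nr rE def_d => [|d IHd] r u nr rE def_d du.
  have -> : r = #|E| by apply/eqP; rewrite eqn_leq rE -subn_eq0 def_d.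
  exact: arr_ideal_full.
have ltrE : (r < #|E|)%N by rewrite -subn_gt0 def_d.
have /existsP[j uj] : [exists j, u j != 0%N].
  apply: contraTT du => /existsPn u0; rewrite -ltnNge mdegE big1 ?addn0 // => j _.
  by apply/eqP; have := u0 j; rewrite negbK.
have def_u : u = (u - U_(j) + U_(j))%MM.
  by rewrite submK // lep1mP.
rewrite def_u mpolyXD.
have [||g ->] := IHd r.+1 (u - U_(j))%MM (leqW nr) ltrE.
- by rewrite subnS def_d.
- by rewrite def_u mdegD mdeg1 addn1 addnS in du.
rewrite mulr_suml; apply: arr_ideal_sum => T rT.
rewrite -mulrA [g T * _]mulrC mulrA; apply: arr_idealMr.
by apply: arr_ideal_coprodX.
Qed.

Lemma arr_ideal_homog r d f : (n <= r.+1)%N -> (r <= #|E|)%N ->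
  (#|E| <= r + d)%N -> f \is d.-homog -> arr_ideal r f.
Proof.
move=> nr rE Ed /dhomogP hf; rewrite [f]mpolyE big_seq.
apply: arr_ideal_sum => u fu; rewrite -mul_mpolyC mulrC; apply: arr_idealMr.
by apply: arr_ideal_monomial => //; have /= -> := hf u fu.
Qed.

(** The coefficients g T of f need not be permuted by E, as the generators satisfy
relations; their images under the projections are, since f determines them. *)
Lemma arr_ideal_descent r f : (r.+1 < n)%N -> (n <= #|E|)%N ->
  Defs.invariant rV E f -> arr_ideal r.+1 f ->
  exists2 f', Defs.invariant rV E f' /\ arr_ideal r f' &
    in_proper_transfers rV (f - f').
Proof.
move=> rn nE fE [g def_f].
have subE T : T \in subsets r.+1 -> T \subset E by rewrite inE => /andP[].
have cardT T : T \in subsets r.+1 -> #|T| = r.+1 by rewrite inE => /andP[_ /eqP].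
have subM s T : s \in E -> T \in subsets r.+1 -> (T :* s)%g \in subsets r.+1.
  move=> Es rT; rewrite inE card_rcoset cardT // eqxx andbT.
  by rewrite -(rcoset_id Es) mulSg // subE.
have projf T : T \in subsets r.+1 ->
    proj_subst T f = proj_subst T (coprod T) * proj_subst T (g T).
  move=> rT; rewrite {1}def_f /proj_subst lin_subst_sum (bigD1 T) //= lin_substM.
  rewrite big1 ?addr0 // => U /andP[rU neUT]; rewrite lin_substM.
  by rewrite -!/(proj_subst T _) (proj_subst_coprod_eq0 (ltnW rn) rT rU) ?mul0r.
pose h T := coprod T * proj_subst T (g T).
have hE s T : s \in E -> T \in subsets r.+1 -> polact rV s (h T) = h (T :* s^-1)%g.
  move=> Es rT; have rTs : (T :* s^-1)%g \in subsets r.+1 by rewrite subM ?groupV.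
  rewrite /h polact_mul (polact_coprod Es (subE T rT)).
  set U := (T :* s^-1)%g in rTs *; congr (coprod U * _).
  (* Multiplied by proj_subst U (coprod U), both sides become proj_subst U f. *)
  have nzU : proj_subst U (coprod U) != 0.
    by rewrite proj_subst_coprod_neq0 ?subE ?cardT.
  apply: (mulfI nzU); rewrite -(projf U rTs) -[in RHS](fE s Es).
  rewrite -(polact_proj f Es (subE T rT)) (projf T rT) polact_mul.
  by rewrite (polact_proj (coprod T) Es (subE T rT)) (polact_coprod Es (subE T rT)).
have h_def T : h T = coprod T * proj_subst T (g T) by [].
clearbody h.
have actE : [acts E, on subsets r.+1 | rcoset_action gT].
  apply/actsP => s Es T; apply/idP/idP => rT; last by rewrite /= rcosetE subM.
  by have := subM _ _ (groupVr Es) rT; rewrite /= rcosetE rcosetK.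
have tr : in_proper_transfers rV (\sum_(T in subsets r.+1) h T).
  apply: (sum_permuted_transfers actE).
  (* A nonempty set stable under right translations contains all of E. *)
  - move=> T rT; apply/negP => /subsetP fixT.
    have /card_gt0P[t Tt] : (0 < #|T|)%N by rewrite cardT.
    have /subset_leq_card : E \subset T.
      apply/subsetP => s Es; have Et := subsetP (subE T rT) t Tt.
      have /astab1P : (t^-1 * s)%g \in 'C[T | 'Rs]%g by rewrite fixT ?groupM ?groupV.
      by rewrite /= rcosetE => <-; rewrite mem_rcoset invMg invgK mulKVg.
    by rewrite (cardT T rT) leqNgt (leq_trans rn nE).
  by move=> s T Es rT; rewrite (hE s T Es rT) /= rcosetE.
have trE : Defs.invariant rV E (\sum_(T in subsets r.+1) h T).
  move=> s Es; rewrite polact_sum (eq_bigr _ (fun T => hE s T Es)).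
  rewrite [RHS](reindex_acts _ actE (groupVr Es)).
  by apply: eq_bigr => T _; rewrite /= rcosetE.
exists (f - \sum_(T in subsets r.+1) h T); last by rewrite opprB addrC subrK.
split; first by move=> s Es; rewrite polactB fE ?trE.
rewrite def_f -sumrB; apply: arr_ideal_sum => T rT.
have -> : coprod T * g T - h T = coprod T * (proj_subst T (g T) - g T) * -1.
  by rewrite h_def mulrN1 mulrBr opprB.
exact/arr_idealMr/arr_ideal_proj_sub.
Qed.

End Projections.
End Arrangement.

(** * Generators of the invariants modulo transfers *)

Section Quotient.

Variables (k : fieldType) (gT : finGroupType) (E : {group gT}) (n : nat).
Variables (rV : mx_representation k E n).
Implicit Types (f g : {mpoly k[n]}).

Lemma pihomogM_homog d e f g : f \is e.-homog ->
  pihomog mdeg (e + d) (f * g) = f * pihomog mdeg d g.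
Proof.
move=> hf; elim/mpolyind: g => [|c u g _ _ IHg]; first by rewrite mulr0 !pihomog0 mulr0.
rewrite mulrDr !linearD /= mulrDr IHg; congr (_ + _).
rewrite -scalerAr !linearZ /= -scalerAr; congr (_ *: _).
have hu : f * 'X_[u] \is (e + mdeg u).-homog by rewrite dhomogM // dhomogX.
rewrite pihomogX; case: eqP => [<-|/eqP ne]; first by rewrite pihomog_dE.
by rewrite mulr0 (pihomog_ne0 _ hu) // eqn_add2l.
Qed.

(** One step of a Horner scheme: if g is generated, so is anything congruent to
a * g + b. *)
Lemma quotient_generated_step (D : {mpoly k[n]} -> Prop) f g a b :
  (exists r (t : r.-tuple {mpoly k[n]}) (P : {mpoly k[r]}),
    (forall i, Defs.invariant rV E (tnth t i) /\ D (tnth t i)) /\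
    in_proper_transfers rV (g - (P \mPo t))) ->
  Defs.invariant rV E a -> D a -> Defs.invariant rV E b -> D b ->
  in_proper_transfers rV (f - (a * g + b)) ->
  exists r (t : r.-tuple {mpoly k[n]}) (P : {mpoly k[r]}),
    (forall i, Defs.invariant rV E (tnth t i) /\ D (tnth t i)) /\
    in_proper_transfers rV (f - (P \mPo t)).
Proof.
case=> r [t [P [tP gP]]] aE Da bE Db fP.
exists r.+2, [tuple of a :: b :: t].
exists ('X_ord0 * (P \mPo [tuple 'X_(lift ord0 (lift ord0 i)) | i < r])
  + 'X_(lift ord0 ord0)); split.
  move=> i; case: (unliftP ord0 i) => [j ->|->]; last by rewrite tnth0.
  rewrite tnthS; case: (unliftP ord0 j) => [l ->|->]; last by rewrite tnth0.
  by rewrite tnthS.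
rewrite comp_mpolyD rmorphM /= !comp_mpolyXU /=.
have -> : (P \mPo [tuple 'X_(lift ord0 (lift ord0 i)) | i < r])
    \mPo [tuple of a :: b :: t] = P \mPo t.
  rewrite (comp_mpolyEX P) [in RHS](comp_mpolyEX P) linear_sum /=.
  apply: eq_bigr => u _; rewrite comp_mpolyZ; congr (_ *: _).
  rewrite !comp_mpolyX rmorph_prod; apply: eq_bigr => i _.
  by rewrite rmorphXn /= tnth_mktuple comp_mpolyXU -tnth_nth !tnthS.
have -> : f - (a * (P \mPo t) + b) = (f - (a * g + b)) + a * (g - (P \mPo t)).
  by ring.
by apply: in_proper_transfersD => //; apply: in_proper_transfersMl.
Qed.

Lemma invariant_pihomog d f : Defs.invariant rV E f ->
  Defs.invariant rV E (pihomog mdeg d f).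
Proof. by move=> fE s Es; rewrite polactE lin_subst_pihomog -polactE fE. Qed.

Lemma invariant_sum I (s : seq I) (P : pred I) (F : I -> {mpoly k[n]}) :
  (forall i, P i -> Defs.invariant rV E (F i)) ->
  Defs.invariant rV E (\sum_(i <- s | P i) F i).
Proof. by move=> FE x Ex; rewrite polact_sum; apply: eq_bigr => i Pi; rewrite FE. Qed.

Lemma msize_homog_le d e f : f \is d.-homog -> (d < e)%N -> (msize f <= e)%N.
Proof.
move=> /dhomogP hf de; rewrite msizeE; apply/bigmax_leqP_seq => u fu _.
by have /= -> := hf u fu.
Qed.

Lemma msize_sum_le I (s : seq I) (P : pred I) (F : I -> {mpoly k[n]}) e :
  (forall i, P i -> msize (F i) <= e)%N -> (msize (\sum_(i <- s | P i) F i) <= e)%N.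
Proof.
move=> Fe; elim/big_ind: _ => [|f g fe ge|//]; first by rewrite msize0.
by apply: leq_trans (msizeD_le _ _) _; rewrite geq_max fe.
Qed.

Variable z : 'cV[k]_n.

Lemma invariant_norm : Defs.invariant rV E (coprod rV z set0).
Proof.
move=> s Es; rewrite polact_coprod ?sub0set //; congr (coprod _ _ _).
by apply/setP=> t; rewrite mem_rcoset !inE.
Qed.

(** Iterating the descent down to r = 0 leaves a multiple of the norm, and the cofactor is
invariant because the norm is invariant and nonzero. *)
Lemma arr_ideal_norm r f : general_position rV z -> (r < n)%N -> (n <= #|E|)%N ->
  Defs.invariant rV E f -> arr_ideal rV z r f ->
  exists2 g, Defs.invariant rV E g & in_proper_transfers rV (f - coprod rV z set0 * g).
Proof.
case/general_position_dual => c cP rn nE.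
have NE := invariant_norm.
have N0 : coprod rV z set0 != 0.
  have n0 : (0 < n)%N by apply: leq_ltn_trans rn.
  have := proj_subst_coprod_neq0 cP (sub0set E); rewrite cards0 => /(_ n0).
  by apply: contraNneq => ->; rewrite /proj_subst /lin_subst comp_mpoly0.
elim: r rn f => [|r IHr] rn f fE.
  case=> h; have -> : subsets E 0 = [set set0].
    apply/setP=> T; rewrite !inE cards_eq0 andbC; case: eqVneq => // ->.
    exact: sub0set.
  rewrite big_set1 => def_f; exists (h set0); last first.
    by rewrite def_f subrr; apply: in_proper_transfers0.
  by move=> s Es; apply: (mulfI N0); rewrite -{1}(NE s Es) -polact_mul -def_f fE.
move=> /(arr_ideal_descent cP rn nE fE)[f' [f'E rf'] ff'].
have [g gE f'g] := IHr (ltnW rn) f' f'E rf'; exists g => //.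
rewrite -(subrK f' f) -addrA.
exact: in_proper_transfersD.
Qed.

Lemma coprod0_homog : coprod rV z set0 \is #|E|.-homog.
Proof.
rewrite /coprod setD0 -sum1_card; elim/big_rec2: _ => [|s d f _ hf].
  exact: dhomog1.
by apply: dhomogM => //; apply: linform_homog.
Qed.

(** The congruence of f with a multiple of the norm need not respect degrees, so it is
truncated: taking homogeneous components preserves transfers, and the norm is
homogeneous, so the cofactor may be replaced by its part g' of degree less than D. *)
Theorem general_position_quotient :
  general_position rV z -> (0 < n <= #|E|)%N ->
  quotient_generated_by rV (degree_le #|E|).
Proof.
move=> gp /andP[n0 nE] f; have q0 : (0 < #|E|)%N := cardG_gt0 E.
move: {2}(msize f) (leqnn (msize f)) => D; elim: D f => [|D IHD] f fD fE.
  have -> : f = 0 by apply/eqP; rewrite -msize_poly_eq0 -leqn0.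
  exists 0%N, [tuple], 0; split; first by case.
  by rewrite comp_mpoly0 subr0; apply: in_proper_transfers0.
set q := #|E| in nE q0 *; pose N := coprod rV z set0.
pose lo := \sum_(d < q) pihomog mdeg d f.
pose hi := \sum_(d < D) pihomog mdeg (q + d) f.
have def_f : f = lo + hi.
  rewrite [LHS](@pihomog_partitionE _ _ mdeg (q + D)) ?big_split_ord //.
  by apply: leq_trans fD _; rewrite -add1n leq_add2r.
have hiE : Defs.invariant rV E hi by apply: invariant_sum => d _; apply: invariant_pihomog.
have rhi : arr_ideal rV z n.-1 hi.
  have [c cP] := general_position_dual gp.
  apply: arr_ideal_sum => d _; apply: (arr_ideal_homog cP (d := q + d)).
  - by rewrite prednK.
  - exact: leq_trans (leq_pred n) nE.
  - by rewrite addnCA leq_addr.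
  exact: pihomogP.
have [|g gE hig] := arr_ideal_norm gp _ nE hiE rhi; first by rewrite prednK.
pose g' := \sum_(d < D) pihomog mdeg d g.
have g'E : Defs.invariant rV E g' by apply: invariant_sum => d _; apply: invariant_pihomog.
apply: (@quotient_generated_step _ f g' N lo).
- apply: IHD g'E; apply: msize_sum_le => d _.
  exact: (msize_homog_le (pihomogP _ _ _)).
- exact: invariant_norm.
- exact: (msize_homog_le coprod0_homog).
- by apply: invariant_sum => d _; apply: invariant_pihomog.
- apply: msize_sum_le => d _; apply: (msize_homog_le (pihomogP _ _ _)).
  by rewrite ltnS ltnW.
have -> : f - (N * g' + lo) = \sum_(d < D) pihomog mdeg (q + d) (hi - N * g).
  rewrite {1}def_f opprD addrA [lo + hi]addrC addrAC addrK mulr_sumr -sumrB.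
  apply: eq_bigr => d _; rewrite linearB /= pihomogM_homog; last exact: coprod0_homog.
  congr (_ - _); rewrite linear_sum /= (bigD1 d) //= pihomog_id big1 ?addr0 //.
  move=> e ed; apply: (pihomog_ne0 _ (pihomogP _ _ _)).
  by rewrite eqn_add2l.
by apply: in_proper_transfers_sum => d _; apply: in_proper_transfers_pihomog.
Qed.

End Quotient.

(** * Symmetric powers of a plane *)

Section BinaryForms.

Variable k : fieldType.

Lemma infinite_nonroot (f : {poly k}) :
  (forall s : seq k, exists x : k, x \notin s) -> f != 0 ->
  exists x, ~~ root f x.
Proof.
move=> inf nzf; have [s [us ss]] : exists s : seq k, uniq s /\ size s = size f.
  elim: (size f) => [|l [s [us ss]]]; first by exists [::].
  by have [x xs] := inf s; exists (x :: s); rewrite /= xs us ss.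
have [/(max_poly_roots nzf)/(_ us)|/allPn[x _ nx]] := boolP (all (root f) s).
  by rewrite ss ltnn.
by exists x.
Qed.

Lemma sympow_dim2_le m : (0 < sympow_dim 2 m <= m.+1)%N.
Proof.
apply/andP; split.
  have [|i _] := @sympow_mnmP 2 m (U_(ord0) *+ m)%MM.
    by rewrite mdegMn mdeg1 mul1n.
  exact: leq_ltn_trans (ltn_ord i).
pose e (i : 'I_(sympow_dim 2 m)) : 'I_m.+1 := inord (sympow_mnm i ord0).
have degE (i : 'I_(sympow_dim 2 m)) : (sympow_mnm i ord0 + sympow_mnm i (lift ord0 ord0) = m)%N.
  transitivity (mdeg (sympow_mnm i)); last exact: mdeg_sympow_mnm.
  by rewrite mdegE !big_ord_recl big_ord0 addn0.
have le_m (i : 'I_(sympow_dim 2 m)) : (sympow_mnm i ord0 < m.+1)%N.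
  by rewrite ltnS; apply: leq_trans (leq_addr _ _) (eq_leq (degE i)).
have e_inj : injective e.
  move=> i j /(congr1 val); rewrite /= !inordK //.
  move=> eq0; apply: sympow_mnm_inj; apply/mnmP => l.
  case: (unliftP ord0 l) => [l' ->|-> //]; rewrite (ord1 l').
  by apply: (@addnI (sympow_mnm i ord0)); rewrite {2}eq0 !degE.
by have := leq_card e e_inj; rewrite !card_ord.
Qed.

(** The linear form on S^m that evaluates binary forms at P. *)
Definition evcol m (P : 'cV[k]_2) : 'cV[k]_(sympow_dim 2 m) :=
  \col_i ('X_[sympow_mnm i]).@[fun j => P j 0].

Lemma mulmx_evcol m (P : 'cV[k]_2) (v : 'rV[k]_(sympow_dim 2 m)) :
  (v *m evcol m P) 0 0 = (sympow_poly v).@[fun j => P j 0].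
Proof.
rewrite mxE /sympow_poly raddf_sum; apply: eq_bigr => i _ /=.
by rewrite mevalZ mxE.
Qed.

Lemma meval_lin_subst (A : 'M[k]_2) (P : 'cV[k]_2) (f : {mpoly k[2]}) :
  (lin_subst A f).@[fun j => P j 0] = f.@[fun j => (A *m P) j 0].
Proof.
rewrite comp_mpoly_meval; apply: meval_eq => i; rewrite tnth_mktuple mxE raddf_sum.
by apply: eq_bigr => j _; rewrite /= mevalZ mevalXU.
Qed.

Definition det2 (P Q : 'cV[k]_2) : k := P 0 0 * Q 1 0 - P 1 0 * Q 0 0.

(** On the points (1, x), the condition det2 P (rW s *m P) = 0 is the polynomial equation
h s = 0 of degree at most 2 in x, which is trivial exactly when rW s is
scalar. *)
Lemma det2_generic (gT : finGroupType) (E : {group gT})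
    (rW : mx_representation k E 2) :
  (forall s : seq k, exists x : k, x \notin s) ->
  (forall s, s \in E -> is_scalar_mx (rW s) -> s = 1%g) ->
  exists P : 'cV[k]_2, P 0 0 = 1 /\
    forall s, s \in E -> s != 1%g -> det2 P (rW s *m P) != 0.
Proof.
move=> inf nonscalar.
pose h s : {poly k} :=
  (rW s 1 0)%:P + ((rW s 1 1 - rW s 0 0)%:P - (rW s 0 1)%:P * 'X) * 'X.
have nzh s : s \in E -> s != 1%g -> h s != 0.
  move=> Es; apply: contraNneq => hs0; apply/eqP/nonscalar => //.
  have c0 : rW s 1 0 = 0.
    have := congr1 (fun f : {poly k} => f`_0) hs0.
    by rewrite coef0 coefD coefC coefMX addr0.
  have c1 : rW s 1 1 - rW s 0 0 = 0.
    have := congr1 (fun f : {poly k} => f`_1) hs0.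
    by rewrite coef0 coefD coefC coefMX /= coefB coefC coefMX add0r subr0.
  have c2 : rW s 0 1 = 0.
    have := congr1 (fun f : {poly k} => f`_2) hs0.
    rewrite coef0 coefD coefC coefMX /= coefB coefC coefMX /= coefC add0r sub0r.
    by move/eqP; rewrite oppr_eq0 => /eqP.
  apply/is_scalar_mxP; exists (rW s 0 0); apply/matrixP => i j; rewrite mxE.
  case: (unliftP 0 i) => [i' ->|->]; case: (unliftP 0 j) => [j' ->|->] //=.
  - rewrite (ord1 i') (ord1 j') eqxx mulr1n; apply/eqP.
    by rewrite -subr_eq0 -c1; apply/eqP; congr (rW s _ _ - _); apply: val_inj.
  - by rewrite (ord1 i') -[RHS]c0; congr (rW s _ _); apply: val_inj.
  by rewrite (ord1 j') -[RHS]c2; congr (rW s _ _); apply: val_inj.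
have nzH : \prod_(s in E :\ 1%g) h s != 0.
  by apply/prodf_neq0 => s /setD1P[s1 Es]; apply: nzh.
have [x nx] := infinite_nonroot inf nzH.
pose P : 'cV[k]_2 := \col_i (if i == 0 then 1 else x).
exists P; split=> [|s Es s1]; first by rewrite mxE.
have: ~~ root (h s) x.
  apply: contra nx; rewrite (bigD1 s) /=; last by rewrite !inE s1.
  by rewrite rootM => ->.
apply: contra => /eqP d0; rewrite /root -d0 /det2 /h !hornerE; apply/eqP.
rewrite !mxE !big_ord_recl !big_ord0 !mxE /=.
have -> : lift ord0 ord0 = 1 :> 'I_2 by apply: val_inj.
by change ord0 with (0 : 'I_2); ring.
Qed.

(** The separating form is the product of the linear forms L s that vanish at the points
Q s, times a power of the first coordinate, which is 1 at P, to reach degree m. *)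
Lemma sympow_general_position (gT : finGroupType) (E : {group gT})
    (rW : mx_representation k E 2) m (P : 'cV[k]_2) :
  P 0 0 = 1 ->
  (forall s, s \in E -> s != 1%g -> det2 P (rW s *m P) != 0) ->
  general_position (sympow_repr m rW) (evcol m P).
Proof.
move=> P0 gen T sTE cT T1.
pose Q s := rW s^-1%g *m P.
pose L s : {mpoly k[2]} := Q s 1 0 *: 'X_0 - Q s 0 0 *: 'X_1.
have evL s (R : 'cV[k]_2) : (L s).@[fun j => R j 0] = det2 R (Q s).
  rewrite /L mevalB !mevalZ !mevalXU /det2.
  by rewrite mulrC [Q s 0 0 * _]mulrC.
pose T' := T :\ 1%g.
have cT' : (#|T'| <= m)%N.
  rewrite -ltnS; apply: leq_trans (proj2 (andP (sympow_dim2_le m))).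
  by apply: leq_trans cT; rewrite (cardsD1 1%g T) T1.
pose c0 := \prod_(s in T') det2 P (Q s).
pose f : {mpoly k[2]} := c0^-1 *: (\prod_(s in T') L s * 'X_0 ^+ (m - #|T'|)).
have hf : f \is m.-homog.
  have hX (i : 'I_2) : ('X_i : {mpoly k[2]}) \is 1.-homog.
    by rewrite dhomogX; apply/eqP/mdeg1.
  rewrite rpredZ //; move: (subnKC cT') => {2}<-; apply: dhomogM; last first.
    by have := dhomogMn (m - #|T'|) (hX 0); rewrite mul1n.
  rewrite -sum1_card; elim/big_rec2: _ => [|s d g _ hg]; first exact: dhomog1.
  by apply: dhomogM => //; rewrite rpredB // rpredZ.
have nzc0 : c0 != 0.
  apply/prodf_neq0 => s /setD1P[s1 Ts].
  by rewrite gen ?groupV ?(subsetP sTE) ?invg_eq1.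
exists (\row_i f@_(sympow_mnm i)) => t Tt.
have Et := subsetP sTE t Tt.
rewrite [LHS]mx11_scalar; congr (_%:M); rewrite /orbit_vec mulmxA mulmx_evcol.
rewrite (sympow_poly_mulmx (rW t^-1%g)) sympow_poly_onto // meval_lin_subst.
rewrite mevalZ mevalM rmorph_prod rmorphXn /= mevalXU -/(Q t).
have [->|t1] := eqVneq t 1%g.
  have -> : Q 1%g = P by rewrite /Q invg1 repr_mx1 mul1mx.
  rewrite P0 expr1n mulr1; under eq_bigr => s _ do rewrite evL.
  by rewrite mulVf.
rewrite (bigD1 t) /=; last by rewrite !inE t1.
by rewrite evL /det2 [Q t 1 0 * _]mulrC subrr !mul0r mulr0.
Qed.

End BinaryForms.

(** The Frobenius map is injective, so 1 is the only p-th root of unity. *)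
Lemma pchar_scalar_repr (p : nat) (k : fieldType) (gT : finGroupType)
    (E : {group gT}) (d : nat) (rW : mx_representation k E d) s :
  p \in [pchar k] -> mx_faithful rW -> s \in E -> (s ^+ p = 1)%g ->
  is_scalar_mx (rW s) -> s = 1%g.
Proof.
move=> pk faith Es sp /is_scalar_mxP[a def_a].
suff s1 : rW s = 1%:M.
  by apply/set1gP/(subsetP faith)/rkerP.
case: d rW faith def_a => [|d] rW faith def_a; first by rewrite [LHS]flatmx0 [RHS]flatmx0.
have : a ^+ p = 1.
  have := repr_mxX rW p Es; rewrite sp repr_mx1 def_a -rmorphXn /=.
  by move=> /matrixP/(_ 0 0); rewrite !mxE eqxx !mulr1n => <-.
move=> ap1; rewrite def_a; congr (_%:M); apply/eqP; rewrite -subr_eq0.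
have : (a - 1) ^+ p = 0.
  by rewrite -(pFrobenius_autE pk) rmorphB rmorph1 /= pFrobenius_autE ap1 subrr.
by move/eqP; rewrite expf_eq0 => /andP[].
Qed.

Theorem theorem1p3 (p q : nat) (gT : finGroupType) (E : {group gT})
    (k : fieldType) (rW : mx_representation k E 2) (m : nat)
    (p_prime : prime p)
    (E_elementary_abelian : (p.-abelem E)%g)
    (E_order : #|E| = q)
    (k_infinite : forall s : seq k, exists x : k, x \notin s)
    (k_char : p \in [pchar k])
    (W_faithful : mx_faithful rW)
    (W_indecomposable : mx_indecomposable rW)
    (m_lt_q : (m < q)%N) :
  quotient_generated_by (sympow_repr m rW) (degree_le q).
Proof.
have nonscalar s : s \in E -> is_scalar_mx (rW s) -> s = 1%g.
  move=> Es; apply: (pchar_scalar_repr k_char W_faithful Es).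
  exact: (proj2 (abelemP p_prime E_elementary_abelian)).
have [P [P0 genP]] := det2_generic k_infinite nonscalar.
have /andP[n0 nm] := sympow_dim2_le m.
rewrite -E_order; apply: (general_position_quotient (sympow_general_position P0 genP)).
by rewrite n0 (leq_trans nm) // E_order.
Qed.
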